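(* Let $G$ be a group and let $L,N$ be normal subgroups of $G$ with $L\geqslant N$. Assume $\mathcal{W}(G,L,N)$ is nonzero and finite dimensional, $\ell=\dim_{\mathbb{R}}\mathcal{W}(G,L,N)$. Take any basis of $\mathcal{W}(G,L,N)$ and representatives $\nu_1,\dots,\nu_\ell\in\mathrm{Q}(N)^G$, and define $\Phi^{\mathbb{R}}\colon[G,N]\to\mathbb{R}^\ell$ by $\Phi^{\mathbb{R}}(y)=(\nu_1(y),\dots,\nu_\ell(y))$. Then: (1) $\Phi^{\mathbb{R}}\colon([G,N],d_{\mathrm{scl}_{G,N}})\to(\mathbb{R}^\ell,\|\cdot\|_1)$ is a pre-coarse homomorphism; (2) for all $y_1,y_2\in[G,N]$, $\|\Phi^{\mathbb{R}}(y_1)-\Phi^{\mathbb{R}}(y_2)\|_1\le 2\big(\sum_j\mathscr{D}(\nu_j)\big)d_{\mathrm{scl}_{G,N}}(y_1,y_2)+\sum_j\mathscr{D}(\nu_j)$; (3) there exist constants $\mathscr{C}_1,\mathscr{C}_2>0$ depending only on $(\nu_1,\dots,\nu_\ell)$ such that for every $d_{\mathrm{scl}_{G,L}}$-bounded set $A\subseteq[G,N]$, with $D_A$ its $d_{\mathrm{scl}_{G,L}}$-diameter, and all $y_1,y_2\in A$, $$\|\Phi^{\mathbb{R}}(y_1)-\Phi^{\mathbb{R}}(y_2)\|_1\ge\frac{2}{\mathscr{C}_1\mathscr{C}_2}d_{\mathrm{scl}_{G,N}}(y_1,y_2)-\frac{(2D_A+1)\mathscr{C}_1+1}{\mathscr{C}_1\mathscr{C}_2}.$$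 In particular $\Phi^{\mathbb{R}}$ is a coarse homomorphism and its restriction to every $d_{\mathrm{scl}_{G,L}}$-bounded set is a quasi-isometric embedding.
   Context: $[G,N]$ is generated by $[g,x]=gxg^{-1}x^{-1}$ ($g\in G,x\in N$); $\mathrm{cl}_{G,N}$ word length w.r.t. these; $\mathrm{scl}_{G,N}(y)=\lim_n\mathrm{cl}_{G,N}(y^n)/n$; $d_{\mathrm{scl}_{G,N}}(y_1,y_2)=\mathrm{scl}_{G,N}(y_1^{-1}y_2)$, and $d_{\mathrm{scl}_{G,L}}$ defined likewise on $[G,N]\subseteq[G,L]$. Defect $\mathscr{D}(\psi)=\sup|\psi(h_1h_2)-\psi(h_1)-\psi(h_2)|$. $\mathrm{Q}(N)^G$: homogeneous quasimorphisms on $N$ invariant under $G$-conjugation; $\mathrm{H}^1(N)^G$: $G$-invariant homomorphisms; $\mathcal{W}(G,L,N)=\mathrm{Q}(N)^G/(\mathrm{H}^1(N)^G+\{\psi|_N:\psi\in\mathrm{Q}(L)^G\})$. Pre-coarse homomorphism: $\sup\|\Phi(yy')-\Phi(y)-\Phi(y')\|<\infty$; coarse homomorphism: controlled pre-coarse homomorphism; quasi-isometric embedding: $C_1d-D_1\le d'\le C_2d+D_2$. *)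

(* Defs.v *)
From HB Require Import structures.
From mathcomp Require Import all_boot all_order all_algebra.
From mathcomp Require Import all_classical all_reals all_analysis.
Set Implicit Arguments. Unset Strict Implicit. Unset Printing Implicit Defensive.
Import Order.TTheory GRing.Theory Num.Theory.
Import numFieldNormedType.Exports.
Local Open Scope ring_scope.
Local Open Scope classical_set_scope.

Record AbsGroup := {
  gcar :> Type;
  gmul : gcar -> gcar -> gcar;
  ginv : gcar -> gcar;
  gone : gcar;
  gmulA : forall x y z, gmul x (gmul y z) = gmul (gmul x y) z;
  gmul1 : forall x, gmul gone x = x;
  gmulV : forall x, gmul (ginv x) x = gone }.

Section GroupDefs.
Variable G : AbsGroup.
Local Notation "x *g y" := (gmul x y) (at level 40, left associativity).

Definition gnpow (x : G) (n : nat) : G := iter n (gmul x) (gone G).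
Definition gzpow (x : G) (z : int) : G :=
  match z with Posz n => gnpow x n | Negz n => ginv (gnpow x n.+1) end.

Definition gcomm (g x : G) : G := g *g x *g ginv g *g ginv x.

Definition normal_subgroup (N : set G) : Prop :=
  [/\ N (gone G),
      (forall x y, N x -> N y -> N (x *g y)),
      (forall x, N x -> N (ginv x)) &
      (forall g x, N x -> N (g *g x *g ginv g))].

(* generators of [G,N] (symmetrised, as usual for word length) *)
Definition GN_gen (N : set G) (c : G) : Prop :=
  exists g x, N x /\ (c = gcomm g x \/ c = ginv (gcomm g x)).

Inductive prod_gens (N : set G) : nat -> G -> Prop :=
| pg0 : prod_gens N 0 (gone G)
| pgS n c y : GN_gen N c -> prod_gens N n y -> prod_gens N n.+1 (c *g y).

Definition mixed_comm (N : set G) : set G := [set y | exists n, prod_gens N n y].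

Variable R : realType.

Definition cl (N : set G) (y : G) : R :=
  inf [set (n%:R : R) | n in [set n | prod_gens N n y]].

Definition scl (N : set G) (y : G) : R :=
  limn (fun n : nat => cl N (gnpow y n.+1) / (n.+1)%:R).

Definition d_scl (N : set G) (y1 y2 : G) : R := scl N (ginv y1 *g y2).

Definition quasimorphism (N : set G) (psi : G -> R) : Prop :=
  exists D : R, forall x y, N x -> N y -> `|psi (x *g y) - psi x - psi y| <= D.
Definition homogeneous (N : set G) (psi : G -> R) : Prop :=
  forall (x : G) (z : int), N x -> psi (gzpow x z) = z%:~R * psi x.
Definition G_invariant (N : set G) (psi : G -> R) : Prop :=
  forall g x, N x -> psi (g *g x *g ginv g) = psi x.

Definition inQG (N : set G) (psi : G -> R) : Prop :=
  [/\ quasimorphism N psi, homogeneous N psi & G_invariant N psi].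
Definition inH1G (N : set G) (h : G -> R) : Prop :=
  (forall x y, N x -> N y -> h (x *g y) = h x + h y) /\ G_invariant N h.

Definition in_W_kernel (L N : set G) (f : G -> R) : Prop :=
  exists h phi, [/\ inH1G N h, inQG L phi & forall x, N x -> f x = h x + phi x].

Definition defect (N : set G) (psi : G -> R) : R :=
  sup [set r | exists x y, [/\ N x, N y & r = `|psi (x *g y) - psi x - psi y|]].

Definition l1norm (l : nat) (v : 'I_l -> R) : R := \sum_(i < l) `|v i|.

Definition pre_coarse_hom (l : nat) (S : set G) (Phi : G -> 'I_l -> R) : Prop :=
  exists C : R, forall y y', S y -> S y' ->
    l1norm (fun i => Phi (y *g y') i - Phi y i - Phi y' i) <= C.

Definition controlled (l : nat) (S : set G) (d : G -> G -> R)
  (Phi : G -> 'I_l -> R) : Prop :=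
  forall r : R, exists s : R, forall y y', S y -> S y' -> d y y' <= r ->
    l1norm (fun i => Phi y i - Phi y' i) <= s.

Definition coarse_hom (l : nat) (S : set G) (d : G -> G -> R)
  (Phi : G -> 'I_l -> R) : Prop :=
  pre_coarse_hom S Phi /\ controlled S d Phi.

Definition qi_embedding (l : nat) (A : set G) (d : G -> G -> R)
  (Phi : G -> 'I_l -> R) : Prop :=
  exists C1 C2 D1 D2 : R, [/\ 0 < C1, 0 < C2, 0 <= D1, 0 <= D2 &
    forall y1 y2, A y1 -> A y2 ->
      C1 * d y1 y2 - D1 <= l1norm (fun i => Phi y1 i - Phi y2 i) <= C2 * d y1 y2 + D2].

Definition d_bounded (A : set G) (d : G -> G -> R) : Prop :=
  exists M : R, forall y1 y2, A y1 -> A y2 -> d y1 y2 <= M.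

Definition diameter (A : set G) (d : G -> G -> R) : R :=
  sup [set r | exists y1 y2, [/\ A y1, A y2 & r = d y1 y2]].

End GroupDefs.

(* Main.v *)
Require Import Defs.
From HB Require Import structures.
From mathcomp Require Import all_boot all_order all_algebra.
From mathcomp Require Import all_classical all_reals all_analysis.
From mathcomp Require Import ring lra.
Import Order.TTheory GRing.Theory Num.Theory.
Import numFieldNormedType.Exports.
Local Open Scope ring_scope.
Local Open Scope classical_set_scope.

(* The upper bounds follow from the easy half of Bavard duality,
   [|psi y| <= 2 D(psi) scl(y)].  The lower bounds reduce to an estimate
   [scl_N y <= M (scl_L y + sum_i |nu_i y|)] on [[G,N]], which is a uniform
   boundedness principle for [Q(N)^G].  The stable mixed commutator length extends
   to a subadditive function on integral chains of elements of [N], finite on a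
   subgroup only; additive functionals dominated by it restrict to invariant
   homogeneous quasimorphisms on [N].  A Hahn-Banach theorem for abelian groups
   yields, for each [y] in [[G,N]], one whose value at [y] is [scl_N y], and a
   gliding hump combines countably many of them into one.  If the estimate failed
   for every [M], the combined quasimorphism could not be of the form
   [h + phi|_N + sum_i c_i nu_i]. *)

Local Notation "x *g y" := (gmul x y) (at level 40, left associativity).
Local Notation "x ^-g" := (ginv x) (at level 3, format "x ^-g").
Local Notation "1g" := (gone _).

(** * Hahn-Banach extension for abelian groups *)

Lemma real_between (R : realType) (Lo U : set R) :
  (forall a b, Lo a -> U b -> a <= b) -> (Lo !=set0 <-> U !=set0) ->
  exists a, (forall b, Lo b -> b <= a) /\ (forall b, U b -> a <= b).
Proof.
(* Two empty sets impose no constraint and 0 serves. The equivalence [eq0] excludes a single empty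
   set, where the other one, if unbounded, could leave no admissible value. *)
move=> LoU eq0; have [U0|U0] := pselect (U !=set0); last first.
  exists 0; split=> b Xb; first by exfalso; apply/U0/eq0; exists b.
  by exfalso; apply: U0; exists b.
have [x Lox] := eq0.2 U0; exists (inf U); split=> b Xb.
  by apply: lb_le_inf => // c Uc; exact: LoU.
by apply: ge_inf => //; exists x => c Uc; exact: LoU.
Qed.

Section HahnBanach.
Variables (R : realType) (E : zmodType) (B : E -> R -> Prop).
Hypothesis BD : forall u v c d, B u c -> B v d -> B (u + v) (c + d).
Hypothesis B00 : B 0 0.
Hypothesis B0_ge0 : forall c, B 0 c -> 0 <= c.
Hypothesis B_sym : forall u c, B u c -> exists c', B (- u) c'.

Lemma dominated_mulrn u c n : B u c -> B (u *+ n) (c *+ n).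
Proof. by move=> Bu; elim: n => // n IHn; rewrite !mulrS; exact: BD. Qed.

(* Partial additive functionals, encoded by their graphs. *)
Let good (T : set (E * R)) :=
  (forall p q, T p -> T q -> T (p - q)) /\
  (forall u a c, T (u, a) -> B u c -> a <= c).

Let good_opp T p : good T -> T p -> T (- p).
Proof.
by move=> [TB _] Tp; have := TB _ _ (TB _ _ Tp Tp) Tp; rewrite subrr sub0r.
Qed.

Let good_add T p q : good T -> T p -> T q -> T (p + q).
Proof.
move=> gT Tp Tq; rewrite -[q]opprK; apply: gT.1 => //; exact: good_opp.
Qed.

Let good_mulrn T p n : good T -> T 0 -> T p -> T (p *+ n).
Proof.
by move=> gT T0 Tp; elim: n => // n IHn; rewrite mulrS; exact: good_add.
Qed.

Let pairMn (x : E) (y : R) k : (x, y) *+ k = (x *+ k, y *+ k).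
Proof. by elim: k => [|k IHk]; rewrite ?mulr0n// !mulrS IHk. Qed.

Let pairMz (x : E) (y : R) z : (x, y) *~ z = (x *~ z, y *~ z).
Proof. by case: z => n; rewrite ?NegzE ?mulrNz -!pmulrn pairMn. Qed.

(** Domination confines the new value at [e] to an interval: [U] collects the constraints from
    positive multiples of [e], [Lo] those from negative multiples. *)
Let good_extend T e : good T -> T 0 ->
  exists a, good [set q | exists p z, T p /\ q = p + (e, a) *~ z].
Proof.
move=> gT T0.
pose U := [set x | exists v b c n,
  [/\ T (v, b), B (v + e *+ n.+1) c & x = (c - b) / n.+1%:R]].
pose Lo := [set x | exists v b c n,
  [/\ T (v, b), B (v - e *+ n.+1) c & x = (b - c) / n.+1%:R]].
have [||a [Loa aU]] := @real_between R Lo U.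
- move=> _ _ [v [b [c [n [Tv Bv ->]]]]] [w [d [f [m [Tw Bw ->]]]]].
  rewrite ler_pdivrMr ?ltr0n// mulrAC ler_pdivlMr ?ltr0n//.
  have Tvw : T (v *+ m.+1 + w *+ n.+1, b *+ m.+1 + d *+ n.+1).
    have -> : (v *+ m.+1 + w *+ n.+1, b *+ m.+1 + d *+ n.+1)
      = (v, b) *+ m.+1 + (w, d) *+ n.+1 by rewrite !pairMn.
    by apply: good_add => //; exact: good_mulrn.
  (* Cross-multiplying the two constraints makes the multiples of [e] cancel, so domination on [T]
     compares them. *)
  have Bvw := BD _ _ _ _ (dominated_mulrn _ _ m.+1 Bv) (dominated_mulrn _ _ n.+1 Bw).
  have eqvw : (v - e *+ n.+1) *+ m.+1 + (w + e *+ m.+1) *+ n.+1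
      = v *+ m.+1 + w *+ n.+1.
    by rewrite mulrnBl mulrnDl [e *+ _ *+ _]mulrnAC addrACA addNr addr0.
  rewrite eqvw in Bvw; have := gT.2 _ _ _ Tvw Bvw.
  rewrite -(mulr_natr b) -(mulr_natr d) -(mulr_natr c) -(mulr_natr f).
  move: (n.+1%:R : R) (m.+1%:R : R) => x y.
  lra.
- split=> -[_ [v [b [c [n [Tv /B_sym[c' Bv] _]]]]]].
    exists ((c' - - b) / n.+1%:R), (- v), (- b), c', n; split=> //.
      exact: (good_opp T (v, b)).
    by move: Bv; rewrite opprB addrC.
  exists ((- b - c') / n.+1%:R), (- v), (- b), c', n; split=> //.
    exact: (good_opp T (v, b)).
  by move: Bv; rewrite opprD.
exists a; split.
  move=> _ _ [p [z [Tp ->]]] [q [w [Tq ->]]].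
  exists (p - q), (z - w); split; first exact: gT.1.
  by rewrite mulrzBr opprD addrACA.
move=> u b c [[v d] [z [Tv]]].
rewrite pairMz => -[-> ->] {u b}.
case: z => [[|n]|n].
- by rewrite !mulr0z !addr0; exact: gT.2.
- rewrite -!pmulrn => Bv.
  have /aU : U ((c - d) / n.+1%:R) by exists v, d, c, n.
  rewrite ler_pdivlMr ?ltr0n// mulr_natr; lra.
- rewrite NegzE !mulrNz -!pmulrn => Bv.
  have /Loa : Lo ((d - c) / n.+1%:R) by exists v, d, c, n.
  rewrite ler_pdivrMr ?ltr0n// mulr_natr; lra.
Qed.

(* Hahn-Banach for abelian groups: [B u c] plays the role of [p u <= c] for a
   subadditive [p] that may be infinite off a subgroup. *)
Lemma hahn_banach_zmod : exists F : E -> R,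
  (forall u v, F (u + v) = F u + F v) /\ (forall u c, B u c -> F u <= c).
Proof.
have [T [gT Tmax]] : exists T, good T /\ forall S, T `<` S -> ~ good S.
  apply: Zorn_bigcup => F Fgood Ftot; split; last first.
    by move=> u a c [T FT Tu]; exact: (Fgood _ FT).2.
  move=> p q [T FT Tp] [S FS Sq].
  have [TS|ST] := Ftot _ _ FT FS.
    by exists S => //; apply: (Fgood _ FS).1 => //; exact: TS.
  by exists T => //; apply: (Fgood _ FT).1 => //; exact: ST.
have T0 : T 0.
  have [[p Tp]|T0] := pselect (T !=set0).
    by rewrite -(subrr p); exact: gT.1.
  (* The empty set is [good], so a maximal [T] might a priori be empty; the graph of the zero
     functional on the trivial subgroup then extends it strictly. *)
  exfalso; apply: (Tmax [set 0]).
    split; first by move=> p Tp; case: T0; exists p.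
    by move=> /(_ 0 erefl) T0'; apply: T0; exists 0.
  split; first by move=> _ _ -> ->; rewrite subrr.
  by move=> u a c [-> ->] /B0_ge0.
have Ttot e : exists a, T (e, a).
  have [a ga] := good_extend _ e gT T0.
  exists a; apply: contrapT => nTe; apply: (Tmax _ _ ga); split.
    by move=> p Tp; exists p, 0; rewrite mulr0z addr0.
  by move=> /(_ (e, a)) Te; apply/nTe/Te; exists 0, 1; rewrite add0r mulr1z.
have [F FT] := choice Ttot; exists F; split; last first.
  by move=> u c; exact: gT.2.
(* Domination by [B 0 0] makes the maximal graph single-valued. *)
have Tuniq u a b : T (u, a) -> T (u, b) -> a <= b.
  move=> Ta Tb; rewrite -subr_le0; apply: (gT.2 0) B00.
  by rewrite -(subrr u); exact: gT.1 Ta Tb.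
move=> u v; have Tuv := good_add _ _ _ gT (FT u) (FT v).
by apply/le_anti/andP; split; [exact: Tuniq (FT _) Tuv|exact: Tuniq Tuv (FT _)].
Qed.

End HahnBanach.

(** * Fekete's lemma for subadditive sequences *)

Section Fekete.
Variables (R : realType) (a : nat -> R).
Hypothesis a_ge0 : forall n, 0 <= a n.
Hypothesis aD : forall m n, a (m + n)%N <= a m + a n.

Let a_mul m n : a (n.+1 * m)%N <= n.+1%:R * a m.
Proof.
elim: n => [|n IHn]; first by rewrite mul1n mul1r.
by rewrite mulSn (le_trans (aD _ _))// -[n.+2]add1n natrD mulrDl mul1r lerD2l.
Qed.

(** The limit is the infimum of the quotients. The linear bounds with an additive constant are
    recorded because they replace limits in later estimates. *)
Lemma fekete : exists2 r : R,
  (fun n => a n.+1 / n.+1%:R) @ \oo --> r &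
  (forall n, r * n%:R <= a n) /\
  (forall e, 0 < e -> exists K, forall n, a n <= (r + e) * n%:R + K).
Proof.
pose S := [set a n.+1 / n.+1%:R | n in [set: nat]].
have S0 : S !=set0 by exists (a 1%N / 1%:R), 0%N.
have Slb : has_lbound S.
  by exists 0 => _ [n _ <-]; rewrite divr_ge0.
have lower n : inf S <= a n.+1 / n.+1%:R by apply: ge_inf => //; exists n.
have upper e : 0 < e -> exists K, forall n, a n <= (inf S + e) * n%:R + K.
  move=> e0; have [_ [m _ <-] mS] := inf_adherent e0 (conj S0 Slb).
  (* The constant bounds [a] at remainders modulo [m.+1]; the two copies of [a 0] cover a zero
     remainder and a zero quotient. *)
  exists (m.+1%:R * a 1%N + a 0%N + a 0%N) => n.
  rewrite {1}(divn_eq n m.+1).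
  have ar : a (n %% m.+1)%N <= m.+1%:R * a 1%N + a 0%N.
    case: (n %% m.+1)%N (ltn_pmod n (ltn0Sn m)) => [_|k km].
      by rewrite ler_wpDl// mulr_ge0.
    rewrite -[k.+1]muln1 (le_trans (a_mul _ _))// ler_wpDr//.
    by rewrite ler_wpM2r// ler_nat ltnW.
  have aq : a (n %/ m.+1 * m.+1)%N <= (inf S + e) * n%:R + a 0%N.
    have r0 : 0 <= inf S by apply: lb_le_inf => // _ [k _ <-]; rewrite divr_ge0.
    case q : (n %/ m.+1)%N => [|k].
      by rewrite mul0n ler_wpDl// mulr_ge0// ltW// ltr_wpDl.
    rewrite (le_trans (a_mul _ _))// ler_wpDr//.
    move: mS; rewrite ltr_pdivrMr ?ltr0n// => mS.
    rewrite (le_trans (ler_wpM2l (ler0n _ _) (ltW mS)))//.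
    rewrite mulrCA -natrM ler_wpM2l ?addr_ge0 ?(ltW e0)//.
    by rewrite ler_nat -q leq_divM.
  by rewrite (le_trans (aD _ _))// addrC; lra.
exists (inf S).
  apply/cvgrPdist_le => e e0.
  have e2 : 0 < e / 2 by rewrite divr_gt0.
  have [K aK] := upper _ e2.
  near=> n.
  rewrite ler_distlC; apply/andP; split.
    by apply: le_trans (lower n); rewrite gerBl ltW.
  rewrite ler_pdivrMr ?ltr0n// (le_trans (aK _))//.
  suff : K <= e / 2 * n.+1%:R by lra.
  rewrite mulrC -ler_pdivrMr//.
  by apply: (le_trans (_ : _ <= n%:R)); [near: n; exact: nbhs_infty_ger|rewrite ler_nat].
split=> //; case=> [|n]; first by rewrite mulr0.
by rewrite -ler_pdivlMr ?ltr0n.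
Unshelve. all: by end_near.
Qed.
End Fekete.

(** * Group identities and powers *)

Section Groups.
Variable G : AbsGroup.
Implicit Types x y z g : G.

Lemma gmulKl x y : x^-g *g (x *g y) = y.
Proof. by rewrite gmulA gmulV gmul1. Qed.

Lemma gmul_injl x y z : x *g y = x *g z -> y = z.
Proof. by move=> xyz; rewrite -(gmulKl x y) xyz gmulKl. Qed.

Lemma gmulx1 x : x *g 1g = x.
Proof. by apply: (gmul_injl x^-g); rewrite gmulA gmulV gmul1. Qed.

Lemma ginvK x : x^-g^-g = x.
Proof. by rewrite -[LHS]gmulx1 -(gmulV x) gmulKl. Qed.

Lemma gmulxV x : x *g x^-g = 1g.
Proof. by rewrite -{1}[x]ginvK gmulV. Qed.

Lemma gmulVK x y : x *g (x^-g *g y) = y.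
Proof. by rewrite gmulA gmulxV gmul1. Qed.

Lemma gmulKr x y : y *g x *g x^-g = y.
Proof. by rewrite -gmulA gmulxV gmulx1. Qed.

Lemma gmulVKr x y : y *g x^-g *g x = y.
Proof. by rewrite -gmulA gmulV gmulx1. Qed.

Lemma ginvM x y : (x *g y)^-g = y^-g *g x^-g.
Proof.
by apply: (gmul_injl (x *g y)); rewrite gmulxV gmulA gmulKr gmulxV.
Qed.

Lemma ginv1 : (1g : G)^-g = 1g.
Proof. by rewrite -[LHS]gmulx1 gmulV. Qed.

Definition gE := (ginvM, ginvK, gmulA, gmulKr, gmulVKr, gmulxV, gmulV, gmul1, gmulx1, ginv1).

Lemma gnpowS x n : gnpow x n.+1 = x *g gnpow x n.
Proof. by []. Qed.

Lemma gnpowD x m n : gnpow x (m + n) = gnpow x m *g gnpow x n.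
Proof.
by elim: m => [|m IHm]; rewrite ?gmul1// addSn !gnpowS IHm gmulA.
Qed.

Lemma gnpow_mul x m n : gnpow x (m * n) = gnpow (gnpow x m) n.
Proof.
by elim: n => [|n IHn]; rewrite ?muln0// mulnS gnpowD IHn.
Qed.

Lemma gnpowSr x n : gnpow x n.+1 = gnpow x n *g x.
Proof. by rewrite -addn1 gnpowD /gnpow /= gmulx1. Qed.

Lemma gnpowV x n : gnpow x^-g n = (gnpow x n)^-g.
Proof.
elim: n => [|n IHn]; first by rewrite /gnpow /= ginv1.
by rewrite gnpowSr gnpowS ginvM IHn.
Qed.

Lemma gnpowJ g x n : gnpow (g *g x *g g^-g) n = g *g gnpow x n *g g^-g.
Proof.
elim: n => [|n IHn]; first by rewrite /gnpow /= !gE.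
by rewrite !gnpowS IHn !gE.
Qed.

Lemma gcommV g x : (gcomm g x)^-g = gcomm x g.
Proof. by rewrite /gcomm !gE. Qed.

Lemma gcommJ a g x : a *g gcomm g x *g a^-g = gcomm (a *g g *g a^-g) (a *g x *g a^-g).
Proof. by rewrite /gcomm !gE. Qed.

End Groups.

(** If [s < r], any [n] beyond [K / (r - s)] gives a contradiction; this is how additive constants
    are discarded below. *)
Lemma linear_growth_le (R : realType) (r s K : R) :
  (forall n : nat, r * n%:R <= s * n%:R + K) -> r <= s.
Proof.
move=> rs; rewrite leNgt; apply/negP => sr.
have /andP[_] := archimedean.Num.Theory.truncn_itv (normr_ge0 (K / (r - s))).
set n := (Num.truncn _).+1 => Kn.
have := le_lt_trans (ler_norm _) Kn.
by rewrite ltr_pdivrMr ?subr_gt0//; have := rs n; lra.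
Qed.

(** * Mixed commutator length and the easy half of Bavard duality *)

Section MixedCommutators.
Variables (R : realType) (G : AbsGroup) (N : set G).
Hypothesis nN : normal_subgroup N.
Implicit Types x y z g : G.

Lemma normal1 : N 1g. Proof. by case: nN. Qed.
Lemma normalM x y : N x -> N y -> N (x *g y). Proof. by case: nN => _ h _ _; exact: h. Qed.
Lemma normalV x : N x -> N x^-g. Proof. by case: nN => _ _ h _; exact: h. Qed.
Lemma normalJ g x : N x -> N (g *g x *g g^-g). Proof. by case: nN => _ _ _; exact. Qed.

Lemma normal_gnpow x n : N x -> N (gnpow x n).
Proof. by move=> Nx; elim: n => [|n IHn]; [exact: normal1|exact: normalM]. Qed.

Lemma normal_gcomm g x : N x -> N (gcomm g x).
Proof. by move=> Nx; apply: normalM (normalV _ Nx); exact: normalJ. Qed.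

Lemma GN_gen_comm g x : N x -> GN_gen N (gcomm g x).
Proof. by move=> Nx; exists g, x; split=> //; left. Qed.

Lemma GN_gen_commr g x : N x -> GN_gen N (gcomm x g).
Proof. by move=> Nx; exists g, x; split=> //; right; rewrite gcommV. Qed.

Lemma GN_genJ a c : GN_gen N c -> GN_gen N (a *g c *g a^-g).
Proof.
move=> [g [x [Nx []->]]]; rewrite ?gcommV gcommJ; [exact/GN_gen_comm/normalJ|].
exact/GN_gen_commr/normalJ.
Qed.

Lemma GN_genV c : GN_gen N c -> GN_gen N c^-g.
Proof.
move=> [g [x [Nx []->]]]; exists g, x; split=> //; first by right.
by left; rewrite ginvK.
Qed.

Lemma GN_gen_sub c : GN_gen N c -> N c.
Proof.
by move=> [g [x [Nx []->]]]; [|apply: normalV]; exact: normal_gcomm.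
Qed.

Lemma prod_gens1 c : GN_gen N c -> prod_gens N 1 c.
Proof. by move=> gc; rewrite -[c]gmulx1; apply: pgS => //; exact: pg0. Qed.

Lemma prod_gensM m n x y :
  prod_gens N m x -> prod_gens N n y -> prod_gens N (m + n) (x *g y).
Proof.
move=> mx ny; elim: mx => [|{}m c {}x gc _ IH]; first by rewrite gmul1.
by rewrite -gmulA; exact: pgS.
Qed.

Lemma prod_gensJ a m x : prod_gens N m x -> prod_gens N m (a *g x *g a^-g).
Proof.
elim=> [|{}m c {}x gc _ IH]; first by rewrite !gE; exact: pg0.
have -> : a *g (c *g x) *g a^-g = a *g c *g a^-g *g (a *g x *g a^-g).
  by rewrite !gE.
by apply: pgS => //; exact: GN_genJ.
Qed.

Lemma prod_gensV m x : prod_gens N m x -> prod_gens N m x^-g.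
Proof.
elim=> [|{}m c {}x gc _ IH]; first by rewrite ginv1; exact: pg0.
by rewrite ginvM -addn1; apply: prod_gensM IH _; exact/prod_gens1/GN_genV.
Qed.

Lemma prod_gens_sub m x : prod_gens N m x -> N x.
Proof.
elim=> [|{}m c {}x gc _ Nx]; first exact: normal1.
by apply: normalM => //; exact: GN_gen_sub.
Qed.

Lemma mixed_comm_sub : mixed_comm N `<=` N.
Proof. by move=> x [m]; exact: prod_gens_sub. Qed.

Lemma mixed_commM x y : mixed_comm N x -> mixed_comm N y -> mixed_comm N (x *g y).
Proof. by move=> [m mx] [n ny]; exists (m + n)%N; exact: prod_gensM. Qed.

Lemma mixed_commV x : mixed_comm N x -> mixed_comm N x^-g.
Proof. by move=> [m mx]; exists m; exact: prod_gensV. Qed.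

Lemma mixed_comm_gnpow x n : mixed_comm N x -> mixed_comm N (gnpow x n).
Proof.
by move=> Nx; elim: n => [|n IHn]; [exists 0%N; exact: pg0|exact: mixed_commM].
Qed.

Lemma cl_le m x : prod_gens N m x -> cl R N x <= m%:R.
Proof.
by move=> mx; apply: ge_inf; [exists 0 => _ [k _ <-]|exists m].
Qed.

Lemma cl_attained x : mixed_comm N x -> exists2 m, prod_gens N m x & cl R N x = m%:R.
Proof.
move=> [m0 m0x].
have ex : exists m, `[< prod_gens N m x >] by exists m0; apply/asboolP.
case: (ex_minnP ex) => m /asboolP mx mmin; exists m => //.
apply/le_anti; rewrite cl_le//=; apply: lb_le_inf; first by exists m%:R, m.
by move=> _ [k /= kx <-]; rewrite ler_nat; apply: mmin; apply/asboolP.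
Qed.

Lemma cl_ge0 x : 0 <= cl R N x.
Proof.
rewrite /cl; have [[m mx]|nx] := pselect (mixed_comm N x).
  by apply: lb_le_inf; [exists m%:R, m|move=> _ [k _ <-]].
(* Off [mixed_comm N] the set of lengths is empty, and its [inf] is 0 by convention. *)
rewrite (_ : [set n | _] = set0) ?image_set0 ?inf0//.
by apply/seteqP; split=> // m mx; case: nx; exists m.
Qed.

Lemma clM x y : mixed_comm N x -> mixed_comm N y ->
  cl R N (x *g y) <= cl R N x + cl R N y.
Proof.
move=> /cl_attained[m mx ->] /cl_attained[n ny ->].
by rewrite -natrD; apply: cl_le; exact: prod_gensM.
Qed.

Lemma scl_bounds y : mixed_comm N y ->
  (forall n, scl R N y * n%:R <= cl R N (gnpow y n)) /\
  (forall e, 0 < e ->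
     exists K, forall n, cl R N (gnpow y n) <= (scl R N y + e) * n%:R + K).
Proof.
move=> Ny; have [||r ar rP] := @fekete R (fun n => cl R N (gnpow y n)).
- by move=> n; exact: cl_ge0.
- by move=> m n; rewrite gnpowD; apply: clM; exact: mixed_comm_gnpow.
by rewrite /scl (cvg_lim _ ar).
Qed.

Lemma le_scl y r c K : mixed_comm N y -> 0 <= c ->
  (forall n, r * n%:R <= c * cl R N (gnpow y n) + K) -> r <= c * scl R N y.
Proof.
move=> Ny c0 rc; apply/ler_addgt0Pr => e e0.
(* Dividing by [c + 1] instead of [c] covers the case [c = 0]. *)
have e'0 : 0 < e / (c + 1) by rewrite divr_gt0// ltr_wpDl.
have [K' clK] := (scl_bounds _ Ny).2 _ e'0.
apply: (@le_trans _ _ (c * (scl R N y + e / (c + 1)))); last first.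
  rewrite mulrDr lerD2l mulrCA ler_piMr ?(ltW e0)//.
  by rewrite ler_pdivrMr ?mul1r ?lerDl// ltr_wpDl.
apply: (linear_growth_le _ _ _ (c * K' + K)) => n.
apply: le_trans (rc n) _; rewrite addrA lerD2r -mulrA -mulrDr.
by rewrite ler_wpM2l.
Qed.

Lemma scl_ge0 y : mixed_comm N y -> 0 <= scl R N y.
Proof.
move=> Ny; rewrite -[scl R N y]mul1r; apply: (le_scl _ _ _ 0) => // n.
by rewrite mul0r mul1r addr0 cl_ge0.
Qed.

Lemma defectP psi x y : quasimorphism N psi -> N x -> N y ->
  `|psi (x *g y) - psi x - psi y| <= defect N psi :> R.
Proof.
move=> [D psiD] Nx Ny; apply: ub_le_sup; last by exists x, y.
by exists D => _ [u [v [Nu Nv ->]]]; exact: psiD.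
Qed.

Lemma defect_ge0 psi : quasimorphism N psi -> 0 <= defect N psi :> R.
Proof.
by move=> Qpsi; apply: le_trans (defectP _ _ _ Qpsi normal1 normal1).
Qed.

Section InvariantQuasimorphism.
Variable psi : G -> R.
Hypothesis Qpsi : inQG N psi.

Let qpsi : quasimorphism N psi. Proof. by case: Qpsi. Qed.

Lemma inQG_gnpow x n : N x -> psi (gnpow x n) = n%:R * psi x.
Proof. by case: Qpsi => _ h _ /(h x n%:Z). Qed.

Lemma inQGV x : N x -> psi x^-g = - psi x.
Proof.
case: Qpsi => _ h _ /(h x (Negz 0)).
by rewrite /gzpow /gnpow /= gmulx1 => ->; rewrite NegzE mulrNz mulN1r.
Qed.

(** A mixed commutator is a conjugate of [x] times the inverse of [x]; their values under [psi]
    cancel by invariance, leaving one defect. *)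
Lemma inQG_gen c : GN_gen N c -> `|psi c| <= defect N psi.
Proof.
have comm g x : N x -> `|psi (gcomm g x)| <= defect N psi.
  move=> Nx; have := defectP _ _ _ qpsi (normalJ g _ Nx) (normalV _ Nx).
  rewrite inQGV//; case: Qpsi => _ _ ->//.
  by rewrite opprK subrK.
move=> [g [x [Nx []->]]]; first exact: comm.
by rewrite inQGV ?normrN; [exact: comm|exact: normal_gcomm].
Qed.

(** Each factor costs one defect for its own value and one for the multiplication, whence the 2. *)
Lemma inQG_prod_gens m x : prod_gens N m x ->
  `|psi x| <= 2 * defect N psi * m%:R.
Proof.
elim=> [|{}m c {}x gc mx IH].
  by have := inQG_gnpow 1g 0 normal1; rewrite mul0r mulr0 /= => ->; rewrite normr0.
have := defectP _ _ _ qpsi (GN_gen_sub _ gc) (prod_gens_sub _ _ mx).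
have := inQG_gen _ gc; rewrite -[m.+1]addn1 natrD mulrDr mulr1 => cD dD.
rewrite (_ : psi (c *g x) = (psi (c *g x) - psi c - psi x) + (psi c + psi x)); last by lra.
rewrite (le_trans (ler_normD _ _))// (le_trans (lerD dD (ler_normD _ _)))//.
by lra.
Qed.

(* The easy half of Bavard duality. *)
Lemma inQG_le_scl y : mixed_comm N y -> `|psi y| <= 2 * defect N psi * scl R N y.
Proof.
move=> Ny; have D0 := defect_ge0 _ qpsi.
apply: (le_scl _ _ _ 0) => // [|n]; first by rewrite mulr_ge0.
have [m mx ->] := cl_attained _ (mixed_comm_gnpow _ n Ny).
rewrite addr0 -[n%:R]ger0_norm// -normrM mulrC -inQG_gnpow; last exact: mixed_comm_sub.
exact: inQG_prod_gens.
Qed.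

End InvariantQuasimorphism.

End MixedCommutators.

(** * Norming functionals and the gliding hump *)

Section GlidingHump.
Variables (R : realType) (E : zmodType) (B : E -> R -> Prop).
Hypothesis BD : forall u v c d, B u c -> B v d -> B (u + v) (c + d).
Hypothesis B00 : B 0 0.
Hypothesis B_ge0 : forall u c, B u c -> 0 <= c.
Hypothesis B_opp : forall u c, B u c -> B (- u) c.

Lemma additive_opp (F : E -> R) u : {morph F : u v / u + v} -> F (- u) = - F u.
Proof.
move=> FD; have F0 : F 0 = 0 by apply: (addrI (F 0)); rewrite -FD !addr0.
by apply: (addrI (F u)); rewrite -FD !subrr.
Qed.

Lemma dominated_norm (F : E -> R) M u c : {morph F : u v / u + v} ->
  (forall u c, B u c -> F u <= M * c) -> B u c -> `|F u| <= M * c.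
Proof.
move=> FD FM Buc; rewrite ler_norml FM// andbT lerNl -additive_opp//.
exact/FM/B_opp.
Qed.

(** Allowing multiples of [v] to be added at price [- r] each gives a relation [B'] that is still
    subadditive, is nonnegative at 0 by the hypothesis on [v *+ n], and holds at [- v] with value
    [- r]. A functional dominated by it is at least [r] at [v]. *)
Lemma norming_functional v r : 0 <= r -> (exists c, B v c) ->
  (forall n c, B (v *+ n) c -> r *+ n <= c) ->
  exists F : E -> R, [/\ {morph F : u v / u + v},
    forall u c, B u c -> F u <= c & r <= F v].
Proof.
move=> r0 [cv Bv] Br.
pose B' u d := exists (n : nat) c, B (u + v *+ n) c /\ c - r *+ n <= d.
have [||||F [FD FB]] := @hahn_banach_zmod R E B'.
- move=> u w c d [n [a [Ba ac]]] [m [b [Bb bd]]].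
  exists (n + m)%N, (a + b); split; last by rewrite mulrnDr; lra.
  by rewrite mulrnDr addrACA; exact: BD.
- by exists 0%N, 0; rewrite !mulr0n !addr0.
- move=> d [n [c []]]; rewrite add0r => /Br; lra.
- move=> u d [n [c [Buc cd]]].
  (* Negating [u + v *+ n] flips the sign of the multiple of [v]; adding [v *+ (n + n)], finite by
     [cv], restores it. *)
  exists (c + cv *+ (n + n) - r *+ n), n, (c + cv *+ (n + n)); split=> //.
  have -> : - u + v *+ n = - (u + v *+ n) + v *+ (n + n).
    by rewrite opprD -addrA mulrnDr addKr.
  by apply: BD; [exact: B_opp|exact: dominated_mulrn].
exists F; split=> //.
  move=> u c Buc; apply: FB; exists 0%N, c; split.
    by rewrite mulr0n addr0.
  by rewrite mulr0n subr0.
rewrite -lerN2 -additive_opp//; apply: FB; exists 1%N, 0.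
by rewrite !mulr1n addNr sub0r.
Qed.

Variables (psi : nat -> E -> R) (v : nat -> E).
Hypothesis psiD : forall k, {morph psi k : u v / u + v}.
Hypothesis psiB : forall k u c, B u c -> psi k u <= c.
Hypothesis psi_ge0 : forall k, 0 <= psi k (v k).

(** Partial sums of a signed series in [3^-1 ^+ k * psi k]. Each sign agrees with that of the
    previous partial sum at [v k], so the new term cannot be cancelled there. *)
Fixpoint hump k (u : E) : R := if k is k'.+1 then
  hump k' u + (if 0 <= hump k' (v k') then 1 else -1) * 3^-1 ^+ k' * psi k' u
  else 0.

Let humpD k : {morph hump k : u v / u + v}.
Proof.
elim: k => [|k IHk] u w /=; first by rewrite addr0.
by rewrite IHk psiD mulrDr addrACA.
Qed.

(** The added multiple of [c] is the geometric tail from [k] on; passing to the next stage changes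
    [hump] by at most the term that leaves the tail. *)
Let hump_decr k j u c : B u c ->
  hump (k + j) u + 3 / 2 * 3^-1 ^+ (k + j) * c <= hump k u + 3 / 2 * 3^-1 ^+ k * c.
Proof.
move=> Buc; elim: j => [|j]; first by rewrite addn0.
apply: le_trans; rewrite addnS /= exprS; set x := _ ^+ (k + j).
have x0 : 0 <= x by rewrite exprn_ge0// invr_ge0.
have : `|psi (k + j) u| <= c.
  rewrite -[c]mul1r; apply: dominated_norm => // w d.
  by rewrite mul1r; exact: psiB.
rewrite ler_norml => /andP[/(ler_wpM2l x0) p1 /(ler_wpM2l x0) p2].
case: ifP => _; lra.
Qed.

Let hump_large k : 3^-1 ^+ k * psi k (v k) <= `|hump k.+1 (v k)|.
Proof.
have p0 : 0 <= 3^-1 ^+ k * psi k (v k) by rewrite mulr_ge0// exprn_ge0// invr_ge0.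
rewrite /= -mulrA; case: ifPn => [h0|]; rewrite ?mul1r ?mulN1r.
  by rewrite (le_trans _ (ler_norm _))// lerDr.
by rewrite -ltNge => h0; rewrite -normrN (le_trans _ (ler_norm _))//; lra.
Qed.

(* The dominating relation below says that [F] differs from the k-th partial sum
   by at most [3/2 * 3^-k] in norm, so no series has to be summed. *)
Lemma gliding_hump : exists F : E -> R, [/\ {morph F : u v / u + v},
  forall u c, B u c -> F u <= 3 / 2 * c &
  forall k c, B (v k) c ->
    3^-1 ^+ k * (psi k (v k) - c / 2) <= `|F (v k)|].
Proof.
pose B' u d := exists k c, B u c /\ hump k u + 3 / 2 * 3^-1 ^+ k * c <= d.
have [||||F [FD FB]] := @hahn_banach_zmod R E B'.
- move=> u w c d [n [a [Ba ac]]] [m [b [Bb bd]]].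
  (* By [hump_decr] both bounds can be carried to a common stage. *)
  exists (n + m)%N, (a + b); split; first exact: BD.
  have := hump_decr n m _ _ Ba; have := hump_decr m n _ _ Bb.
  by rewrite (addnC m) humpD; lra.
- by exists 0%N, 0; rewrite /= mulr0 addr0.
- move=> d [n [c [B0c]]]; apply: le_trans.
  have -> : hump n 0 = 0.
    by apply: (addrI (hump n 0)); rewrite -humpD !addr0.
  by rewrite add0r !mulr_ge0 ?exprn_ge0 ?invr_ge0//; exact: B_ge0 B0c.
- move=> u d [n [c [Buc _]]].
  by exists (hump n (- u) + 3 / 2 * 3^-1 ^+ n * c), n, c; split=> //; exact: B_opp.
exists F; split=> //.
  move=> u c Buc; apply: FB; exists 0%N, c; split=> //.
  by rewrite /= add0r expr0 mulr1.
move=> k c Bc.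
(* At stage [k.+1] the tail is [3^-1 ^+ k * c / 2], half the weight of the k-th term, so that term
   survives. *)
have near w : B w c -> F w <= hump k.+1 w + 3 / 2 * 3^-1 ^+ k.+1 * c.
  by move=> Bw; apply: FB; exists k.+1, c.
have := near _ Bc; have := near _ (B_opp _ _ Bc).
rewrite !additive_opp// => h1 h2; have := hump_large k; move: h1 h2.
rewrite exprS; set x := 3^-1 ^+ k; move: (hump k.+1 (v k)) => h h1 h2 h3.
have : `|h| <= `|F (v k)| + x * (c / 2).
  rewrite -[h](subKr (F (v k))) (le_trans (ler_normB _ _))// lerD2l ler_norml.
  by apply/andP; split; lra.
lra.
Qed.

End GlidingHump.

(** * Integral chains and the hard half of Bavard duality *)

Section Chains.
Variables (R : realType) (G : AbsGroup) (N : set G).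
Hypothesis nN : normal_subgroup N.
Local Notation T := {classic G}.
Implicit Types (s t r : seq T) (x y g : G) (c d : R).

(** The stable length of a chain is the growth rate in [n] of the length of such products of n-th
    powers. *)
Definition power_prod (n : nat) (s : seq T) : G :=
  foldr (fun (x : T) a => gnpow (x : G) n *g a) 1g s.

Lemma power_prod_cat n s t :
  power_prod n (s ++ t) = power_prod n s *g power_prod n t.
Proof. by elim: s => [|x s IHs] /=; rewrite ?gmul1// IHs gmulA. Qed.

Lemma power_prod_nseq n m x : power_prod n (nseq m (x : T)) = gnpow x (n * m).
Proof.
by elim: m => [|m IHm] /=; rewrite ?muln0// mulnS gnpowD IHm.
Qed.

Lemma power_prod_sub n s : (forall x : T, x \in s -> N x) -> N (power_prod n s).
Proof.
elim: s => [|x s IHs] sN /=; first exact: normal1.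
apply: normalM => //.
  by apply: normal_gnpow => //; apply: sN; rewrite mem_head.
by apply: IHs => y ys; apply: sN; rewrite inE ys orbT.
Qed.

(* The stable mixed commutator length of the integral chain [s - t] is at most [c]. *)
Definition chain_scl_le s t c := exists K : R, forall n, exists2 m,
  prod_gens N m (power_prod n s *g (power_prod n t)^-g) & m%:R <= c * n%:R + K.

Lemma chain_scl_le_cat s t c s' t' c' : chain_scl_le s t c ->
  chain_scl_le s' t' c' -> chain_scl_le (s ++ s') (t ++ t') (c + c').
Proof.
move=> [K st] [K' st']; exists (K + K') => n.
have [m mst mK] := st n; have [m' mst' mK'] := st' n.
exists (m' + m)%N; last by rewrite natrD; lra.
(* Conjugation preserves word length, so the primed quotient may be conjugated by [power_prod n s]
   and put in front. *)
have := prod_gensM _ _ _ _ _ _ (prod_gensJ _ _ nN (power_prod n s) _ _ mst') mst.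
by rewrite !power_prod_cat !gE.
Qed.

Lemma chain_scl_le_sym s t c : chain_scl_le s t c -> chain_scl_le t s c.
Proof.
move=> [K st]; exists K => n; have [m mst mK] := st n; exists m => //.
by have := prod_gensV _ _ _ _ mst; rewrite !gE.
Qed.

(** Exchanging two adjacent blocks costs a single mixed commutator for every [n], which only changes
    the additive constant. *)
Lemma chain_scl_le_perm s s' t c : perm_eq s s' -> (forall x : T, x \in s -> N x) ->
  chain_scl_le s t c -> chain_scl_le s' t c.
Proof.
move=> ss' sN st.
pose P r := (forall x : T, x \in r -> N x) /\ chain_scl_le r t c.
suff [] : P s' by [].
apply: (@catCA_perm_ind _ P _ s) => //.
move=> {sN st}s1 s2 s3 [sN [K st]]; split.
  by move=> x xs; apply: sN; move: xs; rewrite !mem_cat orbCA.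
exists (K + 1) => n; have [m mst mK] := st n.
exists (1 + m)%N; last by rewrite natrD; lra.
have N1 : N (power_prod n s1).
  by apply: power_prod_sub => x xs; apply: sN; rewrite mem_cat xs.
have := prod_gensM _ _ _ _ _ _ (prod_gens1 _ _ _
  (GN_gen_comm _ _ (power_prod n s2) _ N1)) mst.
by rewrite /gcomm !power_prod_cat !gE.
Qed.

Lemma chain_scl_le_cancel s t r c :
  chain_scl_le (s ++ r) (t ++ r) c -> chain_scl_le s t c.
Proof.
move=> [K st]; exists K => n; have [m mst mK] := st n; exists m => //.
by move: mst; rewrite !power_prod_cat !gE.
Qed.

Lemma chain_scl_le_ge0 s t c : chain_scl_le s t c -> 0 <= c.
Proof.
move=> [K st]; apply: (linear_growth_le _ _ _ K) => n.
by have [m _] := st n; apply: le_trans; rewrite mul0r.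
Qed.

(** Chains live in the group of all functions [T -> int]; [chain_bound] only relates differences of
    finite sums. *)
Definition chain1 (x : T) : T -> int := fun y => (x == y)%:Z.
Definition chain s : T -> int := \sum_(x <- s) chain1 x.

Lemma chainE s (y : T) : chain s y = (count_mem y s)%:Z.
Proof.
rewrite /chain; elim: s => [|x s IHs]; first by rewrite big_nil.
by rewrite big_cons /= PoszD -IHs.
Qed.

Lemma chain_cat s t : chain (s ++ t) = chain s + chain t.
Proof. exact: big_cat. Qed.

Lemma chain_nseq n x : chain (nseq n (x : T)) = chain1 x *+ n.
Proof.
elim: n => [|n IHn]; first by rewrite /chain big_nil.
by rewrite mulrS -IHn /chain big_cons.
Qed.

Lemma chain_inj s t : chain s = chain t -> perm_eq s t.
Proof.
by move=> st; apply/allP => x _ /=; rewrite -eqz_nat -!chainE st.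
Qed.

(** The dominating relation for Hahn-Banach; a function related to no [c] counts as having infinite
    length. *)
Definition chain_bound (u : T -> int) c := exists s t,
  [/\ forall x : T, x \in s -> N x, forall x : T, x \in t -> N x,
      u = chain s - chain t & chain_scl_le s t c].

Lemma chain_bound_ge0 u c : chain_bound u c -> 0 <= c.
Proof. by move=> [s [t [_ _ _]]]; exact: chain_scl_le_ge0. Qed.

Lemma chain_boundD u v c d : chain_bound u c -> chain_bound v d ->
  chain_bound (u + v) (c + d).
Proof.
move=> [s [t [sN tN -> st]]] [s' [t' [sN' tN' -> st']]].
exists (s ++ s'), (t ++ t'); split.
- by move=> x; rewrite mem_cat => /orP[]; [exact: sN|exact: sN'].
- by move=> x; rewrite mem_cat => /orP[]; [exact: tN|exact: tN'].
- by rewrite !chain_cat opprD addrACA.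
- exact: chain_scl_le_cat.
Qed.

Lemma chain_bound00 : chain_bound 0 0.
Proof.
exists [::], [::]; split=> //; first by rewrite subrr.
exists 0 => n; exists 0%N; last by rewrite mul0r addr0.
by rewrite /= !gE; exact: pg0.
Qed.

Lemma chain_bound_opp u c : chain_bound u c -> chain_bound (- u) c.
Proof.
move=> [s [t [sN tN -> st]]]; exists t, s; split=> //.
  by rewrite opprB.
exact: chain_scl_le_sym.
Qed.

(** The strict inequality leaves room for the [e] in [scl_bounds]. *)
Lemma chain_bound_chain1 y c : mixed_comm N y -> scl R N y < c ->
  chain_bound (chain1 y) c.
Proof.
move=> Ny; rewrite -subr_gt0 => e0.
exists [:: (y : T)], [::]; split=> //.
- by move=> x; rewrite inE => /eqP->; exact: mixed_comm_sub.
- by rewrite /chain big_seq1 big_nil subr0.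
have [K] := (scl_bounds R _ _ _ Ny).2 _ e0.
rewrite addrCA subrr addr0 => yK; exists K => n.
have [m mx clm] := cl_attained R _ _ _ (mixed_comm_gnpow _ _ _ n Ny).
by exists m; [rewrite /= !gE|rewrite -clm; exact: yK].
Qed.

(** In any representation of the chain, [s] is a permutation of [n] copies of [y] followed by [t];
    reordering and cancelling [t] leaves a bound on the powers of [y]. *)
Lemma chain_bound_chain1_mulrn y n c : mixed_comm N y ->
  chain_bound (chain1 y *+ n) c -> scl R N y *+ n <= c.
Proof.
move=> Ny [s [t [sN tN u_eq st]]].
have /chain_inj ps : chain s = chain (nseq n (y : T) ++ t).
  by rewrite chain_cat chain_nseq u_eq subrK.
have /(chain_scl_le_cancel _ [::])[K yK] := chain_scl_le_perm _ _ _ _ ps sN st.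
apply: (linear_growth_le _ _ _ K) => k; have [m mx mK] := yK k.
apply: le_trans mK; move: mx; rewrite power_prod_nseq /= !gE => mx.
apply: le_trans (cl_le R _ _ _ _ mx).
apply: le_trans ((scl_bounds R _ _ _ Ny).1 _).
by rewrite -(mulr_natr (scl R N y)) natrM mulrAC mulrA.
Qed.

(** The chains expressing homogeneity, inversion and conjugation invariance have bound 0, so [F]
    kills them; the chain of [x *g y] minus [x] and [y] has bound 1, which bounds the defect by
    [M]. *)
Lemma chain_bound_inQG (F : (T -> int) -> R) M : {morph F : u v / u + v} ->
  (forall u c, chain_bound u c -> F u <= M * c) ->
  inQG N (fun x => F (chain1 x)).
Proof.
move=> FD FM.
have Fabs u c := dominated_norm _ _ _ chain_bound_opp F M u c FD FM.
have F0 : F 0 = 0 by apply: (addrI (F 0)); rewrite -FD !addr0.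
have FN u := additive_opp _ _ _ u FD.
have Fn u n : F (u *+ n) = n%:R * F u.
  by elim: n => [|n IHn]; rewrite ?mulr0n ?mul0r// mulrS FD IHn -natr1 mulrDl mul1r addrC.
have Fz u : chain_bound u 0 -> F u = 0.
  by move=> /Fabs; rewrite mulr0 normr_le0 => /eqP.
have Fpow x n : N x -> F (chain1 (gnpow x n)) = n%:R * F (chain1 x).
  move=> Nx; apply/eqP; rewrite -subr_eq0 -Fn -FN -FD; apply/eqP/Fz.
  exists [:: (gnpow x n : T)], (nseq n (x : T)); split.
  - by move=> y; rewrite inE => /eqP->; exact: normal_gnpow.
  - by move=> y /nseqP[-> _].
  - by rewrite chain_nseq /chain big_seq1.
  exists 0 => k; exists 0%N; last by rewrite mul0r addr0.
  rewrite power_prod_nseq /= -gnpow_mul mulnC !gE; exact: pg0.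
have Finv x : N x -> F (chain1 x^-g) = - F (chain1 x).
  move=> Nx; apply/eqP; rewrite -addr_eq0 -FD; apply/eqP/Fz.
  exists [:: (x^-g : T); (x : T)], [::]; split=> //.
  - move=> y; rewrite !inE => /orP[]/eqP-> //; exact: normalV.
  - by rewrite /chain big_nil subr0 big_cons big_seq1.
  exists 0 => k; exists 0%N; last by rewrite mul0r addr0.
  by rewrite /= gnpowV !gE; exact: pg0.
split.
- exists (M * 1) => x y Nx Ny; rewrite -!FN -!FD; apply: Fabs.
  exists [:: (x *g y : T)], [:: (x : T); (y : T)]; split.
  - by move=> z; rewrite inE => /eqP->; exact: normalM.
  - by move=> z; rewrite !inE => /orP[]/eqP->.
  - by rewrite /chain !big_cons !big_nil !addr0 opprD addrA.
  (* The n-th power of [x *g y], compared with the product of the n-th powers, is a product of [n]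
     generators: each step adds one conjugate of a commutator of [gnpow y n] and [x]. *)
  exists 0 => n; exists n; last by rewrite mul1r addr0.
  rewrite /= gmulx1 gmulx1; elim: n => [|n IHn].
    by rewrite /gnpow /= !gE; exact: pg0.
  have := prod_gensM _ _ _ _ _ _ IHn (prod_gens1 _ _ _
    (GN_genJ _ _ nN (gnpow x n) _ (GN_gen_comm _ _ (gnpow y n) _ Nx))).
  by rewrite addn1 /gcomm !gnpowSr !gE.
- move=> x [n|n] Nx; rewrite /gzpow; first exact: Fpow.
  by rewrite Finv; [rewrite Fpow// NegzE mulrNz mulNr|exact: normal_gnpow].
- move=> g x Nx; apply/eqP; rewrite -subr_eq0 -FN -FD; apply/eqP/Fz.
  exists [:: (g *g x *g g^-g : T)], [:: (x : T)]; split.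
  - by move=> z; rewrite inE => /eqP->; exact: normalJ.
  - by move=> z; rewrite inE => /eqP->.
  - by rewrite /chain !big_seq1.
  exists 1 => n; exists 1%N; last by rewrite mul0r add0r.
  rewrite /= !gmulx1 gnpowJ; apply: prod_gens1.
  by apply: GN_gen_comm; exact: normal_gnpow.
Qed.

(* Hard half of Bavard duality, for countably many elements at once. *)
Lemma bavard_gliding_hump (y : nat -> G) : (forall k, mixed_comm N (y k)) ->
  exists2 psi : G -> R, inQG N psi &
    forall k, 3^-1 ^+ k / 2 * scl R N (y k) <= `|psi (y k)|.
Proof.
move=> Ny.
have /choice[psi psiP] k : exists F : (T -> int) -> R, [/\ {morph F : u v / u + v},
    forall u c, chain_bound u c -> F u <= c & scl R N (y k) <= F (chain1 (y k))].
  apply: norming_functional.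
  - exact: chain_boundD.
  - exact: chain_bound00.
  - exact: chain_bound_opp.
  - exact: scl_ge0.
  - by exists (scl R N (y k) + 1); apply: chain_bound_chain1; rewrite ?ltrDl.
  - by move=> n c; exact: chain_bound_chain1_mulrn.
have [|||F [FD FM Fy]] := @gliding_hump R (T -> int) chain_bound
    chain_boundD chain_bound00 chain_bound_ge0 chain_bound_opp
    psi (fun k => chain1 (y k)).
- by move=> k; case: (psiP k).
- by move=> k; case: (psiP k).
- by move=> k; case: (psiP k) => _ _; apply: le_trans; exact: scl_ge0.
exists (fun x => F (chain1 x)); first exact: chain_bound_inQG FD FM.
move=> k; case: (psiP k) => _ _ psi_y.
have x0 : 0 < (3^-1 : R) ^+ k by rewrite exprn_gt0// invr_gt0.
apply/ler_addgt0Pr => e e0.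
(* [Fy] needs a bound strictly above [scl]; this slack, multiplied by [3^-1 ^+ k], is [e]. *)
have e'0 : 0 < e / 3^-1 ^+ k by rewrite divr_gt0.
have := Fy k (scl R N (y k) + e / 3^-1 ^+ k).
have /[swap]/[apply] : chain_bound (chain1 (y k)) (scl R N (y k) + e / 3^-1 ^+ k).
  by apply: chain_bound_chain1; rewrite ?ltrDl.
have : 3^-1 ^+ k * (e / 3^-1 ^+ k) = e by rewrite mulrCA mulfV ?mulr1// gt_eqF.
move: psi_y => /(ler_wpM2l (ltW x0)); lra.
Qed.

End Chains.

(** * The uniform estimate on the mixed commutator subgroup *)

Lemma prod_gensS (G : AbsGroup) (N L : set G) m x :
  N `<=` L -> prod_gens N m x -> prod_gens L m x.
Proof.
move=> NL; elim=> [|{}m c {}x [g [z [Nz cE]]] _ IH]; first exact: pg0.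
by apply: pgS => //; exists g, z; split=> //; exact: NL.
Qed.

Lemma mixed_commS (G : AbsGroup) (N L : set G) :
  N `<=` L -> mixed_comm N `<=` mixed_comm L.
Proof. by move=> NL x [m mx]; exists m; exact: prod_gensS mx. Qed.

(** Invariance makes [h] cancel on each generator, so the homomorphism part of the kernel is
    invisible on the mixed commutator subgroup. *)
Lemma inH1G_mixed_comm (R : realType) (G : AbsGroup) (N : set G) (h : G -> R) y :
  normal_subgroup N -> inH1G N h -> mixed_comm N y -> h y = 0.
Proof.
move=> nN [hM hJ] [m]; have h1 : h 1g = 0.
  by apply: (addrI (h 1g)); rewrite -hM ?gmul1 ?addr0//; exact: normal1.
have hV x : N x -> h x^-g = - h x.
  move=> Nx; apply: (addrI (h x)); rewrite -hM ?gmulxV ?subrr//.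
  exact: normalV.
have hcomm g x : N x -> h (gcomm g x) = 0.
  move=> Nx; rewrite hM ?hJ ?hV ?subrr//; [exact: normalJ|exact: normalV].
elim=> // {}m c {}y gc my hy; rewrite hM ?hy ?addr0; last 2 first.
- exact: GN_gen_sub.
- exact: prod_gens_sub my.
case: gc => g [x [Nx []->]]; first exact: hcomm.
by rewrite hV ?hcomm ?oppr0//; exact: normal_gcomm.
Qed.

(* If no constant worked, some invariant quasimorphism would be large, relative
   to the right-hand side, along a sequence in [G,N]; but it differs from a
   restriction from [L] by a combination of the [nu i], up to a homomorphism. *)
Lemma scl_le_scl_nu (R : realType) (G : AbsGroup) (L N : set G) (l : nat)
  (nu : 'I_l -> G -> R) :
  normal_subgroup L -> normal_subgroup N -> N `<=` L ->
  (forall psi : G -> R, inQG N psi ->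
     exists c : 'I_l -> R,
       in_W_kernel L N (fun x => psi x - \sum_(i < l) c i * nu i x)) ->
  exists2 M : R, 0 < M & forall y, mixed_comm N y ->
    scl R N y <= M * (scl R L y + \sum_(i < l) `|nu i y|).
Proof.
move=> nL nN NL spanW; apply: contrapT => noM.
pose w y := scl R L y + \sum_(i < l) `|nu i y|.
have w0 y : mixed_comm N y -> 0 <= w y.
  move=> Ny; apply: addr_ge0; last exact: sumr_ge0.
  exact/scl_ge0/(mixed_commS _ _ _ NL).
(* The factor [3 ^+ k * 2] compensates the loss in [bavard_gliding_hump], and [k] is there to exceed
   any constant. *)
have /choice[y yP] (k : nat) : exists y,
    mixed_comm N y /\ k%:R * 3 ^+ k * 2 * w y < scl R N y.
  apply: contrapT => nok; apply: noM; exists (k%:R * 3 ^+ k * 2 + 1).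
    by rewrite ltr_wpDl// !mulr_ge0// exprn_ge0.
  move=> y Ny; rewrite leNgt; apply/negP => lty; apply: nok; exists y; split=> //.
  apply: le_lt_trans lty; rewrite -/(w y) ler_wpM2r ?w0//.
  by rewrite lerDl.
have Ny k : mixed_comm N (y k) by case: (yP k).
have [psi Qpsi psiy] := bavard_gliding_hump R _ _ nN y Ny.
have [c [h [phi [Hh Qphi psiE]]]] := spanW psi Qpsi.
pose C := 2 * defect L phi + \sum_(i < l) `|c i|.
have qphi : quasimorphism L phi by case: Qphi.
have psi_le k : `|psi (y k)| <= C * w (y k).
  have Ly := mixed_commS _ _ _ NL _ (Ny k).
  have -> : psi (y k) = phi (y k) + \sum_(i < l) c i * nu i (y k).
    have := psiE _ (mixed_comm_sub _ _ nN _ (Ny k)).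
    by rewrite (inH1G_mixed_comm _ _ _ _ _ nN Hh (Ny k)) add0r => /eqP;
      rewrite subr_eq => /eqP.
  apply: le_trans (ler_normD _ _) _.
  have phiy := inQG_le_scl _ _ _ nL _ Qphi _ Ly.
  have s0 := scl_ge0 R _ _ _ Ly.
  have D0 := defect_ge0 _ _ _ nL _ qphi.
  have nu0 : 0 <= \sum_(i < l) `|nu i (y k)| by exact: sumr_ge0.
  have c0 : 0 <= \sum_(i < l) `|c i| by exact: sumr_ge0.
  have cnu : `|\sum_(i < l) c i * nu i (y k)| <=
      (\sum_(i < l) `|c i|) * \sum_(i < l) `|nu i (y k)|.
    rewrite (le_trans (ler_norm_sum _ _ _))// mulr_suml ler_sum// => i _.
    rewrite normrM ler_wpM2l// (bigD1 i)//= lerDl; exact: sumr_ge0.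
  rewrite /C /w; nra.
have C0 : 0 <= C.
  by rewrite addr_ge0 ?mulr_ge0 ?sumr_ge0//; exact: defect_ge0 qphi.
(* At an index above [C] the lower bound on [psi (y k)] strictly exceeds [k%:R * w (y k)], against
   the upper bound [C * w (y k)]. *)
pose k := (Num.truncn C).+1.
have Ck : C < k%:R by case/andP: (archimedean.Num.Theory.truncn_itv C0).
have [_ wk] := yP k; have := psiy k; have := psi_le k; have := w0 _ (Ny k).
have x0 : 0 < (3^-1 : R) ^+ k / 2 by rewrite divr_gt0// exprn_gt0// invr_gt0.
have : (3^-1 ^+ k / 2) * (k%:R * 3 ^+ k * 2 * w (y k)) = k%:R * w (y k).
  have e3 : (3^-1 : R) ^+ k * 3 ^+ k = 1 by rewrite -exprMn mulVf ?expr1n.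
  transitivity ((3^-1 ^+ k * 3 ^+ k) * (k%:R * w (y k))); last by rewrite e3 mul1r.
  by field.
move: wk; rewrite -(ltr_pM2l x0) => wk eqk w0k p1 p2.
have := ler_wpM2r w0k (ltW Ck); lra.
Qed.

(** * Upper and lower coarse bounds *)

Theorem theorem6p1 (R : realType) (G : AbsGroup) (L N : set G) (l : nat)
  (nu : 'I_l -> G -> R) :
  normal_subgroup L -> normal_subgroup N -> N `<=` L ->
  (0 < l)%N ->
  (* representatives in Q(N)^G *)
  (forall i, inQG N (nu i)) ->
  (* their classes in W(G,L,N) are linearly independent *)
  (forall c : 'I_l -> R,
     in_W_kernel L N (fun x => \sum_(i < l) c i * nu i x) -> forall i, c i = 0) ->
  (* and span W(G,L,N) *)
  (forall psi : G -> R, inQG N psi ->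
     exists c : 'I_l -> R,
       in_W_kernel L N (fun x => psi x - \sum_(i < l) c i * nu i x)) ->
  let Phi : G -> 'I_l -> R := fun y i => nu i y in
  let GN := mixed_comm N in
  let dN : G -> G -> R := d_scl R N in
  let dL : G -> G -> R := d_scl R L in
  let sD := \sum_(i < l) defect N (nu i) in
  [/\ (* (1) *) pre_coarse_hom GN Phi,
      (* (2) *)
      (forall y1 y2, GN y1 -> GN y2 ->
         l1norm (fun i => Phi y1 i - Phi y2 i) <= 2 * sD * dN y1 y2 + sD),
      (* (3) *)
      (exists C1 C2 : R, [/\ 0 < C1, 0 < C2 &
         forall A : set G, A `<=` GN -> d_bounded A dL ->
         forall y1 y2, A y1 -> A y2 ->
           2 / (C1 * C2) * dN y1 y2
             - ((2 * diameter A dL + 1) * C1 + 1) / (C1 * C2)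
           <= l1norm (fun i => Phi y1 i - Phi y2 i)]),
      (* in particular: coarse homomorphism *)
      coarse_hom GN dN Phi &
      (* and quasi-isometric embedding on d_scl_{G,L}-bounded sets *)
      (forall A : set G, A `<=` GN -> d_bounded A dL -> qi_embedding A dN Phi)].
Proof.
move=> nL nN NL _ Qnu _ spanW Phi GN dN dL sD.
have qnu i : quasimorphism N (nu i) by case: (Qnu i).
have sD0 : 0 <= sD by apply: sumr_ge0 => i _; exact: defect_ge0 (qnu i).
have GNN y : GN y -> N y by exact: mixed_comm_sub.
have GNdiv y1 y2 : GN y1 -> GN y2 -> GN (y1^-g *g y2).
  by move=> G1 G2; apply: mixed_commM => //; exact: mixed_commV.
have dN0 y1 y2 : GN y1 -> GN y2 -> 0 <= dN y1 y2.
  by move=> G1 G2; apply: scl_ge0; exact: GNdiv.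
(* The defect inequality for the pair [y1], [y1^-g *g y2], whose product is [y2]. *)
have nu_diff i y1 y2 : GN y1 -> GN y2 ->
    `|nu i y2 - nu i y1 - nu i (y1^-g *g y2)| <= defect N (nu i).
  move=> G1 G2.
  have := defectP _ _ _ _ y1 (y1^-g *g y2) (qnu i) (GNN _ G1) (GNN _ (GNdiv _ _ G1 G2)).
  by rewrite gmulVK.
have pre : pre_coarse_hom GN Phi.
  exists sD => y y' Gy Gy'; apply: ler_sum => i _.
  by apply: defectP => //; exact: GNN.
have upper y1 y2 : GN y1 -> GN y2 ->
    l1norm (fun i => Phi y1 i - Phi y2 i) <= 2 * sD * dN y1 y2 + sD.
  move=> G1 G2; rewrite /sD mulr_sumr mulr_suml -big_split /=.
  apply: ler_sum => i _; rewrite distrC.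
  have := nu_diff i _ _ G1 G2.
  have := inQG_le_scl _ _ _ nN _ (Qnu i) _ (GNdiv _ _ G1 G2).
  rewrite -/(dN y1 y2) => le1 le2.
  rewrite -(subrK (nu i (y1^-g *g y2)) (Phi y2 i - Phi y1 i)).
  rewrite (le_trans (ler_normD _ _))// addrC; exact: lerD.
have [M M0 sclM] := scl_le_scl_nu _ _ _ _ _ _ nL nN NL spanW.
have lower A : A `<=` GN -> d_bounded A dL -> 0 <= diameter A dL /\
    forall y1 y2, A y1 -> A y2 -> dN y1 y2 <=
      M * (diameter A dL + sD + l1norm (fun i => Phi y1 i - Phi y2 i)).
  move=> AG [K AK].
  have dLD y1 y2 : A y1 -> A y2 -> dL y1 y2 <= diameter A dL.
    move=> A1 A2; apply: ub_le_sup; last by exists y1, y2.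
    by exists K => _ [z1 [z2 [Az1 Az2 ->]]]; exact: AK.
  split.
    have [[y Ay]|A0] := pselect (A !=set0).
      apply: le_trans (dLD _ _ Ay Ay); apply/scl_ge0/(mixed_commS _ _ _ NL).
      by apply: GNdiv; exact: AG.
    (* For empty [A] the diameter is the [sup] of the empty set, which is 0. *)
    rewrite /diameter (_ : [set r | _] = set0) ?sup0//.
    by apply/seteqP; split=> // r [y1 [y2 [Ay1]]]; case: A0; exists y1.
  move=> y1 y2 A1 A2; have G1 := AG _ A1; have G2 := AG _ A2.
  apply: le_trans (sclM _ (GNdiv _ _ G1 G2)) _.
  rewrite ler_wpM2l ?(ltW M0)// -addrA lerD ?dLD//.
  rewrite /sD /l1norm -big_split /=; apply: ler_sum => i _.
  have := nu_diff i _ _ G1 G2.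
  rewrite (distrC (Phi y1 i)) => le1.
  rewrite -[X in `|X| <= _](subKr (nu i y2 - nu i y1)).
  by apply: le_trans (ler_normB _ _) _; rewrite addrC; apply: lerD.
split=> //.
(* The constants are fixed before [A]. Scaling by [t] brings the defect sum below 1, so the 1 in
   [2 * D + 1] absorbs it. *)
- pose t := (1 + sD)^-1.
  have t0 : 0 < t by rewrite invr_gt0 ltr_wpDr.
  have tsD : t * (1 + sD) = 1 by rewrite mulVf// gt_eqF// ltr_wpDr.
  exists (2 * M / t), 1; split=> //; first by rewrite divr_gt0// mulr_gt0.
  move=> A AG Ab y1 y2 A1 A2; have [D0 /(_ _ _ A1 A2)] := lower _ AG Ab.
  have : 0 <= l1norm (fun i => Phi y1 i - Phi y2 i) by exact: sumr_ge0.
  move: (l1norm _) (diameter _ _) (dN _ _) D0 => X D d D0 X0 dM.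
  have C0 : 0 < 2 * M / t by rewrite divr_gt0// mulr_gt0.
  rewrite mulr1; set c := 2 * M / t.
  have -> : 2 / c * d = t * (d / M) by rewrite /c; field; rewrite !gt_eqF.
  have dM' : d / M <= D + sD + X by rewrite ler_pdivrMr// mulrC.
  have -> : ((2 * D + 1) * c + 1) / c = 2 * D + 1 + c^-1.
    by field; rewrite gt_eqF.
  have ci : 0 < c^-1 by rewrite invr_gt0.
  have := ler_wpM2l (ltW t0) dM'.
  have t1 : t <= 1 by nra.
  have tX : t * X <= X by nra.
  have tD : t * D <= D by nra.
  lra.
- split=> // r; exists (2 * sD * r + sD) => y y' Gy Gy' yr.
  by rewrite (le_trans (upper _ _ Gy Gy'))// lerD2r ler_wpM2l// mulr_ge0.
- move=> A AG Ab; have [D0 Alow] := lower _ AG Ab.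
  (* The lower constants rearrange [lower]; the extra 1 keeps the upper slope positive when [sD] is
     0. *)
  exists M^-1, (2 * sD + 1), (diameter A dL + sD), sD; split=> //.
  + by rewrite invr_gt0.
  + by rewrite ltr_wpDl// mulr_ge0.
  + exact: addr_ge0.
  move=> y1 y2 A1 A2; have G1 := AG _ A1; have G2 := AG _ A2.
  rewrite lerBlDl mulrC ler_pdivrMr// mulrC Alow//=.
  rewrite (le_trans (upper _ _ G1 G2))// lerD2r ler_wpM2r ?dN0//.
  by rewrite lerDl.
Qed.
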